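(* Let $k$ be a field and $R=k[x_1,\dots,x_d]$. Let $I=(G)\subset R$ be a principal ideal generated by a nonzero form of degree $\gamma$, and let $F=f_1,\dots,f_d$ be a regular sequence of forms of the same degree $\delta$. Assume that neither $\delta$ nor $\delta+\gamma$ is $0$ in $k$, and let $J$ be the ideal generated by the sequence of forms $GF=Gf_1,\dots,Gf_d$. Then the socle of $R/JI^{d-1}$, hence the socle of $I^{d}/JI^{d-1}$, is generated by the Jacobian determinant $\det\big(\partial(Gf_i)/\partial x_j\big)_{1\le i,j\le d}$.
   Context: The socle of a module is the submodule of elements annihilated by the homogeneous maximal ideal $(x_1,\dots,x_d)$. $R$ has the standard grading. *)

(* Defs.v *)
From HB Require Import structures.
From mathcomp Require Import all_boot all_order all_algebra.
From mathcomp Require Import boolp.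
From mathcomp.multinomials Require Export mpoly.

Set Implicit Arguments.
Unset Strict Implicit.
Unset Printing Implicit Defensive.

Import GRing.Theory.
Local Open Scope ring_scope.
Local Open Scope quotient_scope.

(* Submodules are given by boolean membership predicates, as everywhere in the
   library; [asbool] makes such predicates out of arbitrary, not necessarily
   decidable, submodules.  (The library's [submodClosed] does not entail closure
   under opposites, which quotients require.)  The ideals of a commutative ring R
   are the terms of type [submodule R^o], the improper ideal included. *)
Record submodule (R : comNzRingType) (V : lmodType R) := Submodule {
  submod_pred :> {pred V};
  submod_predP : submod_closed submod_pred
}.

HB.instance Definition _ (R : comNzRingType) (V : lmodType R)
    (N : submodule V) :=
  GRing.isSubmodClosed.Build R V (submod_pred N) (submod_predP N).

Definition submod_zmodClosed (R : comNzRingType) (V : lmodType R)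
    (N : submodule V) : zmodClosed V := submod_pred N.
Coercion submod_zmodClosed : submodule >-> zmodClosed.

Section Span.
Variables (R : comNzRingType) (V : lmodType R).

Definition span_pred (S : V -> Prop) : {pred V} := fun v =>
  `[< exists n (a : 'I_n -> R) (w : 'I_n -> V),
        (forall i, S (w i)) /\ v = \sum_(i < n) a i *: w i >].

Lemma span_submod_closed S : submod_closed (span_pred S).
Proof.
split=> [|c u v].
  apply/asboolP; exists 0%N, (fun=> 0), (fun=> 0); split=> [[]//|].
  by rewrite big_ord0.
move=> /asboolP[m [a [x [Sx ->]]]] /asboolP[n [b [y [Sy ->]]]].
apply/asboolP; exists (m + n)%N.
exists (fun i => match split i with inl j => c * a j | inr j => b j end).
exists (fun i => match split i with inl j => x j | inr j => y j end).
split=> [i|]; first by case: (split i) => j.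
rewrite big_split_ord scaler_sumr; congr (_ + _); apply: eq_bigr => i _.
  by rewrite (unsplitK (inl i)) scalerA.
by rewrite (unsplitK (inr i)).
Qed.

Definition submod_span (S : V -> Prop) : submodule V :=
  Submodule (span_submod_closed S).

End Span.

(* The library quotient {ideal_quot N} is only a Z-module; make it an R-module. *)
Section QuotientModule.
Variables (R : comNzRingType) (V : lmodType R) (N : submodule V).

Definition scaleq (a : R) : {ideal_quot N} -> {ideal_quot N} :=
  lift_op1 {ideal_quot N} (fun v : V => a *: v).

Lemma pi_scaleq (a : R) (v : V) :
  scaleq a (\pi_{ideal_quot N} v) = \pi_{ideal_quot N} (a *: v).
Proof.
rewrite /scaleq; unlock; apply/eqP; rewrite -Quotient.idealrBE -scalerBr.
by apply: rpredZ; rewrite Quotient.idealrBE reprK.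
Qed.

Lemma scaleqA a b u : scaleq a (scaleq b u) = scaleq (a * b) u.
Proof. by rewrite -[u]reprK !pi_scaleq scalerA. Qed.

Lemma scale1q : left_id 1 scaleq.
Proof. by move=> u; rewrite -[u]reprK pi_scaleq scale1r. Qed.

Lemma scaleqDr : right_distributive scaleq +%R.
Proof.
by move=> a u v; rewrite -[u]reprK -[v]reprK -raddfD !pi_scaleq -raddfD -scalerDr.
Qed.

Lemma scaleqDl u : {morph scaleq^~ u : a b / a + b}.
Proof. by move=> a b; rewrite -[u]reprK !pi_scaleq -raddfD -scalerDl. Qed.

HB.instance Definition _ := GRing.Zmodule_isLmodule.Build R {ideal_quot N}
  scaleqA scale1q scaleqDr scaleqDl.

End QuotientModule.

(* The image of a submodule A of V in V/N; it is A/N when N is contained in A. *)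
Definition submod_quot (R : comNzRingType) (V : lmodType R)
    (A N : submodule V) : {pred {ideal_quot N}} :=
  fun u => `[< exists2 v, v \in A & u = \pi_{ideal_quot N} v >].
Arguments submod_quot {R V} A N _.

Section Ideals.
Variable R : comNzRingType.

Definition ideal_of (S : R -> Prop) : submodule R^o :=
  @submod_span R R^o S.

Definition ideal_mul (A B : submodule R^o) : submodule R^o :=
  ideal_of (fun r => exists a b : R, [/\ a \in A, b \in B & r = a * b]).

Fixpoint ideal_exp (A : submodule R^o) (n : nat) : submodule R^o :=
  if n is m.+1 then ideal_mul A (ideal_exp A m) else ideal_of (fun r => r = 1).

Definition regular_sequence (n : nat) (f : 'I_n -> R) : Prop :=
  (forall (i : 'I_n)
     (u : {ideal_quot ideal_of (fun r => exists2 j : 'I_n, (j < i)%N & r = f j)}),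
     f i *: u = 0 -> u = 0)
  /\ exists u : {ideal_quot ideal_of (fun r => exists j : 'I_n, r = f j)}, u != 0.

End Ideals.

Section Polynomials.
Variables (k : fieldType) (d : nat).
Local Notation R := {mpoly k[d]}.

Definition irrelevant_ideal : submodule R^o :=
  ideal_of (fun r : R => exists i : 'I_d, r = 'X_i).

(* The socle of the submodule W of M; that of M itself is [socle predT]. *)
Definition socle (M : lmodType R) (W : {pred M}) : {pred M} := fun u =>
  (u \in W) && `[< forall a : R, a \in irrelevant_ideal -> a *: u = 0 >].

Definition jacobian (h : 'I_d -> R) : 'M[R]_d :=
  \matrix_(i < d, j < d) mderiv j (h i).

End Polynomials.

(* Main.v *)
Require Import Defs.
From mathcomp Require Import all_boot all_order all_algebra.
From mathcomp Require Import boolp ring.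

Set Implicit Arguments.
Unset Strict Implicit.
Unset Printing Implicit Defensive.

Import GRing.Theory.
Local Open Scope ring_scope.
Local Open Scope quotient_scope.

(** With F = (f_1, ..., f_d) the ideal J I^(d-1) is G^d F, so the socle of the quotient is read
    off from the v with x_j v in G^d F for all j.

    Such a v is divisible by G^d. When d > 1, f_1 v = G^d a and f_2 v = G^d b, so f_2 a = f_1 b;
    since f_2 is regular modulo f_1, a = f_1 c and v = G^d c; when d = 1 the ideal F is already
    (f_1) ([colon_vars_divisible]). Writing v = G^d u, the class of u is in the socle of R/F.

    The socle of R/F. Euler's formula writes delta f_i as the combination of the variables with
    coefficients the partial derivatives of f_i, so the matrix of partial derivatives expresses F
    in the variables up to a unit of k. The general fact ([colon_regular_sequence]) is: if
    f_1, ..., f_n is regular modulo an ideal B of a commutative ring and f = A x modulo B, then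
    (B + F) : (x) is contained in B + F + (det A). It is proved by induction on n, replacing f_n
    by a generic linear combination ell of the x_j. Over R[T] take
    ell = x_1 T^(n-1) + ... + x_n. By McCoy's theorem ([mccoy]) ell is regular modulo every ideal
    of R modulo which some element of (x) is regular, so f_1, ..., f_(n-1) is regular modulo
    B + (ell) ([nzd_mod_swap]). As x_n has coefficient 1 in ell, it can be eliminated modulo ell,
    and the induction hypothesis applies to a matrix of size n - 1. To return from ell to f_n,
    let v multiply (x) into B + F and put B' = B + (f_1, ..., f_(n-1)). Then
    ell v = w f_n modulo B' for some w, which multiplies (x) into B' + (ell), and Cramer's rule,
    which gives ell det A = f_n D modulo B' for the determinant D of the reduced matrix, turns the
    description of w into one of v ([exchange]).

    The determinant. The matrix of the forms G f_i has entries G df_i/dx_j + f_i dG/dx_j. By Euler's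
    formula delta times this matrix is the Jacobian matrix of f times the rank-one perturbation
    delta G + x (grad G) of a scalar matrix, whose determinant is computed by
    [det_scalar_add_rank1]; hence
    delta det(d(G f_i)/dx_j) = (delta + gamma) G^d det(df_i/dx_j) ([det_jacobian_mul]). As delta and
    delta + gamma are units, the generator G^d det(df_i/dx_j) may be replaced by the Jacobian
    determinant of the G f_i; it lies in I^d, which settles the socle of I^d / J I^(d-1). *)

(** * Ideals obtained by adjoining elements *)

Section IdealArithmetic.
Variable R : comNzRingType.
Implicit Types (B C : submodule R^o) (f : nat -> R).

Lemma idealM B (c v : R) : v \in B -> c * v \in B.
Proof. exact: (@rpredZ R R^o B c v). Qed.

Lemma ideal0 B : 0 \in B.
Proof. exact: (@rpred0 R^o B). Qed.

Lemma idealD B (u v : R) : u \in B -> v \in B -> u + v \in B.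
Proof. exact: (@rpredD R^o B u v). Qed.

Lemma idealN B (v : R) : v \in B -> - v \in B.
Proof. by rewrite -mulN1r; apply: idealM. Qed.

Lemma idealB B (u v : R) : u \in B -> v \in B -> u - v \in B.
Proof. by move=> Bu Bv; apply: idealD => //; apply: idealN. Qed.

Lemma ideal_sum B (T : finType) (P : pred T) (F : T -> R) :
  (forall i, P i -> F i \in B) -> \sum_(i | P i) F i \in B.
Proof. exact: (@rpred_sum R^o B). Qed.

Lemma ideal_congr B (u v : R) : u - v \in B -> (u \in B) = (v \in B).
Proof.
move=> Buv; apply/idP/idP => [Bu|Bv]; last by rewrite -(subrK v u) idealD.
by rewrite -(subKr u v) idealB.
Qed.

Definition adjoin_pred B (a : R) : {pred R^o} :=
  fun v => `[< exists c : R, (v : R) - c * a \in B >].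

Lemma adjoin_closed B a : submod_closed (adjoin_pred B a).
Proof.
split=> [|c u v]; first by apply/asboolP; exists 0; rewrite mul0r subr0 ideal0.
move=> /asboolP[p Bp] /asboolP[q Bq]; apply/asboolP; exists (c * p + q).
have -> : (c *: u + v : R) - (c * p + q) * a
        = c * ((u : R) - p * a) + ((v : R) - q * a).
  rewrite (_ : c *: u = c * (u : R)) //.
  by ring.
by apply: idealD => //; apply: idealM.
Qed.

Definition adjoin B a : submodule R^o := Submodule (adjoin_closed B a).

Lemma adjoinP B (a v : R) :
  reflect (exists c, v - c * a \in B) (v \in adjoin B a).
Proof. exact: asboolP. Qed.

Lemma mem_adjoin B a : a \in adjoin B a.
Proof. by apply/adjoinP; exists 1; rewrite mul1r subrr ideal0. Qed.

Lemma sub_adjoin B a (v : R) : v \in B -> v \in adjoin B a.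
Proof. by move=> Bv; apply/adjoinP; exists 0; rewrite mul0r subr0. Qed.

Lemma adjoin_sub B C a :
  (forall v : R, v \in B -> v \in C) -> a \in C ->
  forall v : R, v \in adjoin B a -> v \in C.
Proof.
move=> sBC Ca v /adjoinP[c Bv].
by rewrite (ideal_congr (sBC _ Bv)); apply: idealM.
Qed.

Lemma adjoin_mono B C a :
  (forall v : R, v \in B -> v \in C) ->
  forall v : R, v \in adjoin B a -> v \in adjoin C a.
Proof.
move=> sBC v; apply: adjoin_sub (mem_adjoin C a) v => u Bu.
exact/sub_adjoin/sBC.
Qed.

Lemma eq_adjoin B C a : B =i C -> adjoin B a =i adjoin C a.
Proof.
by move=> eqBC v; apply/idP/idP; apply: adjoin_mono => u; rewrite eqBC.
Qed.

Lemma adjoinC B a b (v : R) :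
  v \in adjoin (adjoin B a) b -> v \in adjoin (adjoin B b) a.
Proof.
move=> abv; apply: (adjoin_sub _ _ abv); last first.
  by apply: sub_adjoin; apply: mem_adjoin.
by apply: adjoin_mono => u; apply: sub_adjoin.
Qed.

Definition nzd_mod B (a : R) := forall v : R, a * v \in B -> v \in B.

(** If [b] is regular modulo [B + (a)] and [a] is regular modulo [B], then [a] stays regular
    modulo [B + (b)]: from [a v = b c] modulo [B] one gets [c = a c'], whence
    [a (v - b c')] lies in [B]. *)
Lemma nzd_mod_swap B a b :
  nzd_mod B a -> nzd_mod (adjoin B a) b -> nzd_mod (adjoin B b) a.
Proof.
move=> regB regb v /adjoinP[c Bc].
have /regb/adjoinP[e Be] : b * c \in adjoin B a.
  apply/adjoinP; exists v.
  by rewrite (_ : _ - _ = - (a * v - c * b)); [apply: idealN | ring].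
apply/adjoinP; exists e; apply: regB.
have -> : a * (v - e * b) = (a * v - c * b) + b * (c - e * a) by ring.
by apply: idealD => //; apply: idealM.
Qed.

(** Sequences are indexed by [nat], so that dropping the last term changes only the length. *)
Fixpoint chain B f n : submodule R^o :=
  if n is m.+1 then adjoin (chain B f m) (f m) else B.

Lemma chainS B f n : chain B f n.+1 = adjoin (chain B f n) (f n).
Proof. by []. Qed.

Lemma sub_chain B f n (v : R) : v \in B -> v \in chain B f n.
Proof. by move=> Bv; elim: n => //= n; apply: sub_adjoin. Qed.

Lemma mem_chain B f n i : (i < n)%N -> f i \in chain B f n.
Proof.
elim: n => //= n IHn; rewrite ltnS leq_eqVlt => /predU1P[->|/IHn].
  exact: mem_adjoin.
exact: sub_adjoin.
Qed.

Definition regular_mod B f n := forall i, (i < n)%N -> nzd_mod (chain B f i) (f i).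

End IdealArithmetic.

(** * Extension of ideals to R[T] and McCoy's theorem *)

Section PolynomialExtension.
Variable R : comNzRingType.
Implicit Types (B C : submodule R^o) (f : nat -> R).

Definition polyext_pred B : {pred {poly R}^o} :=
  fun p => `[< forall i, (p : {poly R})`_i \in B >].

Lemma polyext_closed B : submod_closed (polyext_pred B).
Proof.
split=> [|c p q]; first by apply/asboolP=> i; rewrite coef0 ideal0.
move=> /asboolP Bp /asboolP Bq; apply/asboolP=> i.
rewrite (_ : c *: p = c * (p : {poly R})) // coefD coefM.
by apply: idealD => //; apply: ideal_sum => j _; apply: idealM.
Qed.

Definition polyext B : submodule {poly R}^o := Submodule (polyext_closed B).

Lemma polyextP B (p : {poly R}) :
  reflect (forall i, p`_i \in B) (p \in polyext B).
Proof. exact: asboolP. Qed.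

Lemma polyextC B (c : R) : (c%:P \in polyext B) = (c \in B).
Proof.
apply/polyextP/idP => [/(_ 0%N)|Bc i]; first by rewrite coefC.
by rewrite coefC; case: eqP => // _; apply: ideal0.
Qed.

Lemma nzd_polyextC B a : nzd_mod B a -> nzd_mod (polyext B) a%:P.
Proof.
move=> rega p /polyextP Bp; apply/polyextP => i; apply: rega.
by have := Bp i; rewrite coefCM.
Qed.

(** Membership is coefficientwise, which suits McCoy's theorem, but the induction on regular
    sequences also needs the description of the extended ideal by generators. *)
Lemma polyext_adjoin B a (p : {poly R}) :
  (p \in polyext (adjoin B a)) = (p \in adjoin (polyext B) a%:P).
Proof.
apply/polyextP/adjoinP => [|[q /polyextP Bq] i]; last first.
  by apply/adjoinP; exists q`_i; have := Bq i; rewrite coefB coefMC.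
elim/poly_ind: p => [_|p c IHp Bpc].
  by exists 0; rewrite mul0r subr0 ideal0.
have [i|q /polyextP Bq] := IHp.
  by have := Bpc i.+1; rewrite coefD coefMX coefC addr0.
have /adjoinP[e Be] : c \in adjoin B a.
  by have := Bpc 0%N; rewrite coefD coefMX coefC add0r.
exists (q * 'X + e%:P); apply/polyextP => i.
rewrite coefB coefMC !coefD !coefMX !coefC; case: i => [|i] /=.
  by rewrite !add0r.
by rewrite !addr0; have := Bq i; rewrite coefB coefMC.
Qed.

(** McCoy: if p g has its coefficients in B, then so does every p_j g, by induction on the size of g
    and on j. Modulo B, once p_i g = 0 for i < j, the coefficient of T^j in p g is p_j g_0, so
    p_j g is T times a polynomial p_j g' that p still annihilates, with g' shorter than g. *)
Lemma mccoy B (p : {poly R}) :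
  (forall y, (forall j, p`_j * y \in B) -> y \in B) -> nzd_mod (polyext B) p.
Proof.
move=> regp g; move: {-1}(size g) (leqnn (size g)) => m.
elim: m g => [|m IHm] g le_gm pgB.
  by move: le_gm; rewrite leqn0 size_poly_eq0 => /eqP->; apply: ideal0.
suff pgBj j : p`_j *: g \in polyext B.
  apply/polyextP => k; apply: regp => j.
  by have /polyextP/(_ k) := pgBj j; rewrite coefZ.
elim/ltn_ind: j => j IHj.
have pjg0 : p`_j * g`_0 \in B.
  have /polyextP/(_ j) := pgB; rewrite coefM big_ord_recr /= subnn.
  set s := \sum_(i < j) _ => Bpg; rewrite -(addKr s (_ * _)) addrC.
  apply: idealB => //.
  apply: ideal_sum => i _; have /polyextP/(_ (j - i)%N) := IHj i (ltn_ord i).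
  by rewrite coefZ.
have eqg : p`_j *: g = (p`_j * g`_0)%:P + p`_j *: drop_poly 1 g * 'X.
  apply/polyP => -[|i]; rewrite coefD coefC coefMX !coefZ ?addr0 //.
  by rewrite coef_drop_poly addn1 add0r.
rewrite eqg; apply: idealD; first by rewrite polyextC.
rewrite mulrC; apply: idealM; apply: IHm.
  apply: leq_trans (size_scale_leq _ _) _.
  by rewrite size_drop_poly leq_subLR add1n.
have BpgX : p * (p`_j *: drop_poly 1 g) * 'X \in polyext B.
  have -> : p * (p`_j *: drop_poly 1 g) * 'X
          = (p`_j)%:P * (p * g) - (p`_j * g`_0)%:P * p.
    by rewrite [(p`_j)%:P * _]mulrCA [(p`_j)%:P * _]mul_polyC eqg; ring.
  apply: idealB; first exact: idealM.
  by rewrite mulrC; apply: idealM; rewrite polyextC.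
apply/polyextP => k; have /polyextP/(_ k.+1) := BpgX.
by rewrite coefMX.
Qed.

End PolynomialExtension.

(** * Exchanging an element of a regular sequence *)

Section Exchange.
Variable R : comNzRingType.
Implicit Types (B : submodule R^o) (f : nat -> R).

Lemma chain_polyext B f (ell : {poly R}) n :
  chain (adjoin (polyext B) ell) (fun j => (f j)%:P) n
    =i adjoin (polyext (chain B f n)) ell.
Proof.
elim: n => [//|n IHn] p; rewrite !chainS (eq_adjoin _ IHn).
have eqC : adjoin (polyext (chain B f n)) (f n)%:P
             =i polyext (adjoin (chain B f n) (f n)).
  by move=> q; rewrite polyext_adjoin.
by rewrite -(eq_adjoin _ eqC); apply/idP/idP; apply: adjoinC.
Qed.

Lemma cramer n (M : 'M[R]_n) (x : nat -> R) (l : 'I_n) :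
  \det M * x l = \sum_i (\adj M) l i * \sum_j M i j * x j.
Proof.
have /matrixP/(_ l ord0) : \adj M *m (M *m \col_j x j) = \det M *: \col_j x j.
  by rewrite mulmxA mul_adj_mx mul_scalar_mx.
rewrite mxE [X in _ = X]mxE [X in _ = _ * X]mxE => <-.
apply: eq_bigr => i _; rewrite [X in _ * X]mxE; congr (_ * _).
by apply: eq_bigr => j _; rewrite mxE.
Qed.

Section ExchangeStep.
Variables (C : submodule R^o) (n : nat) (x : nat -> R) (g : R).
Variable M : 'M[R]_n.+1.
Hypothesis Mx_low : forall i : 'I_n.+1, (i < n)%N -> \sum_j M i j * x j \in C.
Hypothesis Mx_last : \sum_j M ord_max j * x j - g \in C.
Hypothesis reg_x : nzd_mod C (x n).
Hypothesis reg_g : nzd_mod C g.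

Let D := \det (row' ord_max (col' ord_max M)).

(** Row [ord_max] of Cramer's rule for the last unknown: the rows other than the last contribute
    elements of C, and the entry of the adjugate in front of g is D. *)
Lemma cramer_last : x n * \det M - g * D \in C.
Proof.
rewrite mulrC (cramer M x ord_max) big_ord_recr /=.
have -> : (\adj M) ord_max ord_max = D.
  by rewrite mxE /cofactor /= addnn -mul2n exprM sqrrN !expr1n mul1r.
set s := \sum_(i < n) _; set m := \sum_j _.
have -> : s + D * m - g * D = s + D * (m - g) by ring.
apply: idealD; last exact: idealM.
by apply: ideal_sum => i _; apply: idealM; apply: Mx_low => /=.
Qed.

(** Exchange of [g] for [x n]: with x_n v = w g modulo C, regularity of g carries the condition on v
    over to w, and regularity of x_n together with [cramer_last] carries the conclusion back. *)
Lemma exchange v :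
  (forall w, (forall j : 'I_n.+1, x j * w \in adjoin C (x n)) ->
     w \in adjoin (adjoin C (x n)) D) ->
  (forall j : 'I_n.+1, x j * v \in adjoin C g) ->
  v \in adjoin (adjoin C g) (\det M).
Proof.
move=> socx socv.
have /adjoinP[w Cw] := socv ord_max.
have /socx/adjoinP[e /adjoinP[h Ch]] : forall j : 'I_n.+1, x j * w \in adjoin C (x n).
  move=> j; have /adjoinP[c Cc] := socv j; apply/adjoinP; exists c.
  apply: reg_g.
  have -> : g * (x j * w - c * x n)
          = x n * (x j * v - c * g) - x j * (x n * v - w * g) by ring.
  by apply: idealB; apply: idealM.
apply/adjoinP; exists e; apply/adjoinP; exists h; apply: reg_x.
have -> : x n * (v - e * \det M - h * g)
        = (x n * v - w * g) + g * (w - e * D - h * x n) - e * (x n * \det M - g * D).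
  by ring.
apply: idealB; last by apply: idealM; apply: cramer_last.
by apply: idealD => //; apply: idealM.
Qed.

End ExchangeStep.

End Exchange.

Section Generic.
Variables (R : comNzRingType) (n : nat) (x : nat -> R).

(** The exponents decrease, so that the coefficient of [x n] is 1 and [x n] can be traded for the
    generic form by a change of coordinates of determinant 1. *)
Definition generic_form : {poly R} := \poly_(j < n.+1) x (n - j)%N.

Lemma generic_formE : generic_form = \sum_(j < n.+1) 'X^(n - j) * (x j)%:P.
Proof.
rewrite /generic_form poly_def (reindex_inj rev_ord_inj) /=.
apply: eq_bigr => j _; rewrite subSS subKn ?leq_ord //.
by rewrite -mul_polyC mulrC.
Qed.

Definition generic_coords (j : nat) : {poly R} :=
  if (j < n)%N then (x j)%:P else generic_form.

Definition generic_change : 'M[{poly R}]_n.+1 :=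
  \matrix_(i, j) (if i == j then 1 else if i == ord_max then - 'X^(n - j) else 0).

Lemma det_generic_change : \det generic_change = 1.
Proof.
rewrite det_trig; first by apply: big1 => i _; rewrite mxE eqxx.
apply/is_trig_mxP => i j lt_ij; rewrite mxE -val_eqE /= ltn_eqF //.
by rewrite -val_eqE /= ltn_eqF // (leq_trans lt_ij) // leq_ord.
Qed.

Lemma generic_changeE (i : 'I_n.+1) :
  \sum_j generic_change i j * generic_coords j = (x i)%:P.
Proof.
have [->|i_neq] := eqVneq i ord_max.
  rewrite big_ord_recr /= mxE eqxx mul1r.
  rewrite {2}/generic_coords ltnn generic_formE big_ord_recr /= subnn mul1r.
  rewrite addrA -big_split /= big1 ?add0r // => j _.
  rewrite mxE eqxx -val_eqE /= gtn_eqF ?ltn_ord //.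
  by rewrite /generic_coords ltn_ord; ring.
rewrite (bigD1 i) //= mxE eqxx mul1r big1 ?addr0.
  rewrite /generic_coords ifT // ltn_neqAle -ltnS ltn_ord andbT.
  by move: i_neq; rewrite -val_eqE.
by move=> j j_neq; rewrite mxE eq_sym (negPf j_neq) (negPf i_neq) mul0r.
Qed.

End Generic.

(** The induction passes to R[T] and to the ideal B + (ell); in the coordinates
    x_0, ..., x_(n-1), ell the matrix A becomes a matrix M with the same determinant, whose top left
    block of size n expresses f_0, ..., f_(n-1) modulo B + (ell) in x_0, ..., x_(n-1). The
    result for v is recovered from the one for the constant polynomial v. *)
Theorem colon_regular_sequence n (R : comNzRingType) (B : submodule R^o) (f x : nat -> R)
    (A : 'M[R]_n) (v : R) :
  regular_mod B f n ->
  (forall i : 'I_n, f i - \sum_j A i j * x j \in B) ->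
  (forall j : 'I_n, x j * v \in chain B f n) ->
  v \in adjoin (chain B f n) (\det A).
Proof.
elim: n R B f x A v => [|n IHn] R B f x A v regf fA socv.
  by apply/adjoinP; exists v; rewrite det_mx00 mulr1 subrr ideal0.
pose ell := generic_form n x; pose y := generic_coords n x.
have yn : y n = ell by rewrite /y /generic_coords ltnn.
(* M is A written in the coordinates x_0, ..., x_(n-1), ell. *)
pose M := map_mx polyC A *m generic_change R n.
have detM : \det M = (\det A)%:P.
  by rewrite det_mulmx det_generic_change mulr1 det_map_mx.
have My (i : 'I_n.+1) : \sum_j M i j * y j = (\sum_j A i j * x j)%:P.
  under eq_bigr => j _ do rewrite mxE mulr_suml.
  rewrite exchange_big raddf_sum; apply: eq_bigr => l _ /=.
  under eq_bigr => j _ do rewrite -mulrA.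
  by rewrite -mulr_sumr generic_changeE mxE polyCM.
(* What the coefficients of ell send into [chain B f i], so does f_i, which is modulo B a
   combination of them. *)
have reg_ell i : (i <= n)%N -> nzd_mod (polyext (chain B f i)) ell.
  rewrite -ltnS => lt_in; apply: mccoy => u ell_u.
  apply: (regf _ lt_in); rewrite mulrC.
  have := sub_chain f i (idealM u (fA (Ordinal lt_in))).
  rewrite mulrBr => /ideal_congr->.
  rewrite mulr_sumr; apply: ideal_sum => j _.
  rewrite mulrC -mulrA; apply: idealM.
  have := ell_u (n - j)%N; rewrite coef_poly ltnS leq_subr subKn //.
  exact: leq_ord.
pose C := polyext (chain B f n); pose g := (f n)%:P.
suff : v%:P \in adjoin (adjoin C g) (\det M).
  rewrite detM (eq_adjoin (C := polyext (chain B f n.+1))).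
    by rewrite -polyext_adjoin polyextC.
  by move=> p; rewrite polyext_adjoin.
apply: (exchange (x := y)); rewrite ?yn.
- move=> i lt_in; rewrite My polyextC -(ideal_congr (sub_chain f n (fA i))).
  exact: mem_chain.
- rewrite My /g -polyCB polyextC -opprB; apply: idealN.
  exact: sub_chain (fA ord_max).
- exact: reg_ell.
- by apply: nzd_polyextC; apply: regf.
- move=> w socw; rewrite -(eq_adjoin _ (chain_polyext B f ell n)).
  apply: (IHn _ _ _ (fun j => (x j)%:P)).
  + move=> i lt_in u; rewrite !chain_polyext; move: u.
    apply: nzd_mod_swap; first by apply: nzd_polyextC; apply: regf; apply: ltnW.
    by move=> u; rewrite -!polyext_adjoin; apply: (reg_ell i.+1).
  + move=> i; set S := \sum_j _; apply/adjoinP.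
    pose i' := lift ord_max i; exists (M i' ord_max).
    have eqS : S + M i' ord_max * ell = (\sum_j A i' j * x j)%:P.
      rewrite -My big_ord_recr /= yn; congr (_ + _); apply: eq_bigr => j _.
      rewrite [X in X * _ = _]mxE [X in X * _ = _]mxE /y /generic_coords ltn_ord.
      by congr (M _ _ * _); apply: val_inj; apply: lift_max.
    have -> : (f i)%:P - S - M i' ord_max * ell = (f i - \sum_j A i' j * x j)%:P.
      by rewrite polyCB -eqS; ring.
    by rewrite polyextC; have := fA i'; rewrite lift_max.
  move=> j; rewrite chain_polyext; have := socw (widen_ord (leqnSn n) j).
  by rewrite /y /generic_coords /= ltn_ord.
- move=> j; have socP (i : 'I_n.+1) : (x i)%:P * v%:P \in adjoin C g.
    by rewrite -polyext_adjoin -polyCM polyextC; apply: socv.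
  rewrite /y /generic_coords; case: ifP => _; first exact: socP.
  rewrite generic_formE mulr_suml; apply: ideal_sum => i _.
  by rewrite -mulrA; apply: idealM; apply: socP.
Qed.

(** * Generated, scaled and principal ideals *)

Section IdealOps.
Variable R : comNzRingType.
Implicit Types (B C : submodule R^o) (f : nat -> R) (S : R -> Prop).

Lemma mem_ideal_of S (r : R) : S r -> r \in ideal_of S.
Proof.
move=> Sr; apply/asboolP; exists 1%N, (fun=> 1), (fun=> r); split=> //.
by rewrite big_ord1 scale1r.
Qed.

Lemma ideal_of_sub S B :
  (forall r, S r -> r \in B) -> forall v : R, v \in ideal_of S -> v \in B.
Proof.
move=> SB v /asboolP[n [a [w [Sw ->]]]].
by apply: ideal_sum => i _; apply: idealM; apply: SB.
Qed.

Lemma mem_unit_ideal (v : R) : v \in ideal_of (fun r : R => r = 1).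
Proof. by rewrite -[v]mulr1; apply: idealM; apply: mem_ideal_of. Qed.

Definition zero_ideal : submodule R^o := ideal_of (fun=> False).

Lemma zero_idealE (v : R) : (v \in zero_ideal) = (v == 0).
Proof.
apply/idP/eqP => [|->]; last exact: ideal0.
case/asboolP=> -[|n] [a [w [Sw ->]]]; first by rewrite big_ord0.
by case: (Sw ord0).
Qed.

Lemma chain_ideal_of n (f : 'I_n -> R) (F : nat -> R) m :
    (forall i : 'I_n, F i = f i) -> (m <= n)%N ->
  chain zero_ideal F m =i ideal_of (fun r => exists2 j : 'I_n, (j < m)%N & r = f j).
Proof.
move=> Ff le_mn v; apply/idP/idP; last first.
  by apply: ideal_of_sub => r [j lt_jm ->]; rewrite -Ff; apply: mem_chain.
elim: m le_mn v => [|m IHm] lt_mn v; first by rewrite zero_idealE => /eqP->; apply: ideal0.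
rewrite chainS; apply: adjoin_sub => [u /(IHm (ltnW lt_mn))|].
  apply: ideal_of_sub => r [j lt_jm ->]; apply: mem_ideal_of; exists j => //.
  exact: leqW.
by apply: mem_ideal_of; exists (Ordinal lt_mn) => //=; rewrite -Ff.
Qed.

Definition scale_pred (a : R) B : {pred R^o} :=
  fun v => `[< exists2 u : R, u \in B & (v : R) = a * u >].

Lemma scale_closed a B : submod_closed (scale_pred a B).
Proof.
split=> [|c u v]; first by apply/asboolP; exists 0; rewrite ?mulr0 ?ideal0.
move=> /asboolP[p Bp up] /asboolP[q Bq vq]; apply/asboolP.
exists (c * p + q); first by apply: idealD => //; apply: idealM.
by rewrite (_ : c *: u = c * (u : R)) // up vq; ring.
Qed.

Definition scale_ideal a B : submodule R^o := Submodule (scale_closed a B).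

Lemma scale_idealP a B (v : R) :
  reflect (exists2 u : R, u \in B & v = a * u) (v \in scale_ideal a B).
Proof. exact: asboolP. Qed.

Lemma ideal_exp_principal (a : R) n (v : R) :
  (v \in ideal_exp (ideal_of (fun r => r = a)) n)
    = (v \in scale_ideal (a ^+ n) (ideal_of (fun r => r = 1))).
Proof.
elim: n v => [|n IHn] v; apply/idP/idP.
- by move=> _; apply/scale_idealP; exists v; rewrite ?mul1r ?mem_unit_ideal.
- by move=> _; apply: mem_unit_ideal.
- apply: ideal_of_sub => r [b [c [Ib]]]; rewrite IHn => /scale_idealP[e _ ->] ->.
  have /scale_idealP[h _ ->] : b \in scale_ideal a (ideal_of (fun r => r = 1)).
    apply: ideal_of_sub Ib => _ ->; apply/scale_idealP.
    by exists 1; rewrite ?mulr1 ?mem_unit_ideal.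
  by apply/scale_idealP; exists (h * e); [apply: mem_unit_ideal | rewrite exprS; ring].
case/scale_idealP=> u _ ->; apply: mem_ideal_of; exists a, (a ^+ n * u).
split; [exact: mem_ideal_of | | by rewrite exprS mulrA].
by rewrite IHn; apply/scale_idealP; exists u => //; apply: mem_unit_ideal.
Qed.

Lemma ideal_mul_principal n (a : R) (f : 'I_n -> R) m (v : R) :
  (v \in ideal_mul (ideal_of (fun r => exists i, r = a * f i))
                   (ideal_exp (ideal_of (fun r => r = a)) m))
    = (v \in scale_ideal (a ^+ m.+1) (ideal_of (fun r => exists i, r = f i))).
Proof.
apply/idP/idP.
  apply: ideal_of_sub => r [b [c [Jb]]].
  rewrite ideal_exp_principal => /scale_idealP[e _ ->] ->.
  have : b \in scale_ideal a (ideal_of (fun r => exists i, r = f i)).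
    apply: ideal_of_sub Jb => _ [i ->]; apply/scale_idealP; exists (f i) => //.
    by apply: mem_ideal_of; exists i.
  case/scale_idealP=> h Fh ->; apply/scale_idealP; exists (e * h).
    exact: idealM.
  by rewrite exprS; ring.
case/scale_idealP=> u /asboolP[l [b [w [Fw ->]]]] ->.
have -> : a ^+ m.+1 * \sum_i b i *: w i = \sum_i b i * (a ^+ m.+1 * w i) :> R.
  by rewrite [LHS]mulr_sumr; apply: eq_bigr => i _; apply: mulrCA.
apply: ideal_sum => i _; apply: idealM; have [j ->] := Fw i.
apply: mem_ideal_of; exists (a * f j), (a ^+ m).
split; last by rewrite exprS; ring.
  by apply: mem_ideal_of; exists j.
rewrite ideal_exp_principal; apply/scale_idealP.
by exists 1; rewrite ?mulr1 ?mem_unit_ideal.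
Qed.

End IdealOps.

(** * Submodules of cyclic modules *)

Section CyclicQuotient.
Variables (R : comNzRingType) (N : submodule R^o).

Lemma pi_eq (v u : R) :
  (\pi_{ideal_quot N} v == \pi_{ideal_quot N} u) = (v - u \in N).
Proof. exact: esym (Quotient.idealrBE _ _ _). Qed.

Lemma pi_eq0 (v : R) : (\pi_{ideal_quot N} v == 0) = (v \in N).
Proof. by rewrite -[X in _ = (X \in _)]subr0 -pi_eq raddf0. Qed.

Lemma scale_pi (a v : R) : a *: \pi_{ideal_quot N} v = \pi_{ideal_quot N} (a * v).
Proof. exact: pi_scaleq. Qed.

Lemma span_pi (a v : R) :
  (\pi_{ideal_quot N} v \in submod_span (fun u => u = \pi_{ideal_quot N} a))
    = (v \in adjoin N a).
Proof.
apply/asboolP/adjoinP => [[n [b [w [wa piv]]]]|[c Nv]].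
  exists (\sum_(i < n) b i); rewrite -pi_eq piv; apply/eqP.
  rewrite -scale_pi scaler_suml; apply: eq_bigr => i _; by rewrite wa.
exists 1%N, (fun=> c), (fun=> \pi a); split=> //.
by rewrite big_ord1 scale_pi; apply/eqP; rewrite pi_eq.
Qed.

End CyclicQuotient.

Lemma regular_sequence_mod (R : comNzRingType) n (f : 'I_n -> R) (F : nat -> R) :
  (forall i : 'I_n, F i = f i) -> regular_sequence f -> regular_mod (zero_ideal R) F n.
Proof.
move=> Ff [regf _] i lt_in v.
rewrite !(chain_ideal_of Ff (ltnW lt_in)) => fv.
have := regf (Ordinal lt_in) (\pi v); rewrite scale_pi -Ff /=.
move/(_ (eqP (etrans (pi_eq0 _ _) fv)))/eqP; by rewrite pi_eq0.
Qed.

(** * A determinant identity and Euler's formula *)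

(** The matrix determinant lemma, freed of division by [a]: both sides come from triangulating the
    block matrix with rows (1, -v) and (u, a) by a column operation, in two ways. *)
Lemma det_scalar_add_rank1 (R : comNzRingType) n (a : R) (u : 'cV[R]_n) (v : 'rV[R]_n) :
  a * \det (a%:M + u *m v) = (a + (v *m u) 0 0) * a ^+ n.
Proof.
pose M : 'M_(1 + n) := block_mx 1%:M (- v) u a%:M.
have detM : \det M = \det (a%:M + u *m v).
  have := det_mulmx M (block_mx 1%:M v 0 1%:M).
  rewrite det_ublock !det1 !mulr1 => <-.
  rewrite mulmx_block !mulmx0 !mulmx1 !mul1mx !addr0 subrr.
  by rewrite det_lblock det1 mul1r addrC.
have := det_mulmx M (block_mx a%:M 0 (- u) 1%:M).
rewrite detM det_lblock det1 mulr1 det_scalar1 mulrC => <-.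
rewrite mulmx_block !mulmx0 !mulmx1 !mul1mx !add0r mulNmx mulmxN opprK.
rewrite mulmxN mul_scalar_mx mul_mx_scalar subrr det_ublock det_scalar.
by rewrite det_mx11 !mxE eqxx mulr1n.
Qed.

Section SocleOfForms.
Variables (k : fieldType) (d : nat).
Local Notation R := {mpoly k[d]}.

Lemma euler gamma (p : R) :
  p \is gamma.-homog -> \sum_j 'X_j * mderiv j p = gamma%:R * p.
Proof.
move=> p_hom; rewrite {2}[p]mpolyE mulr_sumr.
have dE j : mderiv j p = \sum_(m <- msupp p) p@_m *: mderiv j 'X_[m].
  by rewrite {1}[p]mpolyE raddf_sum; apply: eq_bigr => m _; exact: mderivZ.
under eq_bigr => j _ do rewrite dE mulr_sumr.
rewrite exchange_big; apply: eq_big_seq => m m_supp /=.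
have XdX j : 'X_j * (p@_m *: mderiv j 'X_[m]) = (m j)%:R * (p@_m *: 'X_[m]).
  rewrite mderivX -!scalerAr; congr (_ *: _).
  have [->|mj_gt0] := posnP (m j); first by rewrite scale0r mul0r.
  rewrite -mpolyXD addmC submK ?scaler_nat ?mulr_natl //.
  by rewrite lep1mP -lt0n.
rewrite (eq_bigr _ (fun j _ => XdX j)) -mulr_suml -natr_sum -mdegE.
by rewrite (dhomog_mf p_hom).
Qed.

Lemma natr_mpoly_neq0 n : n%:R != 0 :> k -> n%:R != 0 :> R.
Proof. by move=> n0; rewrite -mpolyC_nat mpolyC_eq0. Qed.

Lemma mulVr_natr_mpoly n : n%:R != 0 :> k -> (n%:R^-1)%:MP * n%:R = 1 :> R.
Proof. by move=> n0; rewrite -mpolyC_nat -mpolyCM mulVf ?mpolyC1. Qed.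

(** * The socle *)

Variables (gamma delta : nat) (G : R) (f : 'I_d -> R).
Hypothesis G_neq0 : G != 0.
Hypothesis G_form : G \is gamma.-homog.
Hypothesis f_form : forall i, f i \is delta.-homog.
Hypothesis delta_neq0 : delta%:R != 0 :> k.

(** By Euler's formula, delta times the Jacobian matrix of the G f_i is the product of the Jacobian
    matrix of f and the matrix delta G + x (grad G). *)
Lemma det_jacobian_mul :
  delta%:R * \det (jacobian (fun i => G * f i))
    = (delta + gamma)%:R * G ^+ d * \det (jacobian f).
Proof.
pose x : 'cV[R]_d := \col_i 'X_i; pose dG : 'rV[R]_d := \row_j mderiv j G.
have detE : \det (jacobian f *m ((delta%:R * G)%:M + x *m dG))
          = delta%:R ^+ d * \det (jacobian (fun i => G * f i)).
  rewrite -detZ; congr (\det _); apply/matrixP => i j.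
  rewrite mulmxDr mulmxA mul_mx_scalar !mxE mderivM big_ord1 !mxE.
  have -> : \sum_l jacobian f i l * x l 0 = delta%:R * f i.
    by rewrite -(euler (f_form i)); apply: eq_bigr => l _; rewrite !mxE mulrC.
  by ring.
have dGx : (dG *m x) 0 0 = gamma%:R * G.
  by rewrite mxE -(euler G_form); apply: eq_bigr => l _; rewrite !mxE mulrC.
have := det_scalar_add_rank1 (delta%:R * G) x dG.
rewrite dGx => rk1.
apply: (mulfI (expf_neq0 d (natr_mpoly_neq0 delta_neq0))).
apply: (mulfI G_neq0).
rewrite [X in _ * X = _]mulrCA -detE det_mulmx.
set J := \det _; set D := \det _ in rk1 *.
have -> : G * (delta%:R * (J * D)) = J * (delta%:R * G * D) by ring.
by rewrite rk1 exprMn natrD; ring.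
Qed.

Definition extend n (h : 'I_n -> R) (i : nat) : R := oapp h 0 (insub i).

Lemma extendE n (h : 'I_n -> R) (i : 'I_n) : extend h i = h i.
Proof. by rewrite /extend valK. Qed.

Definition ideal_of_forms : submodule R^o := ideal_of (fun r => exists i, r = f i).

Local Notation vars := (extend (fun j : 'I_d => 'X_j)).
Local Notation forms := (extend f).

Lemma chain_forms (v : R) :
  (v \in chain (zero_ideal R) forms d) = (v \in ideal_of_forms).
Proof.
rewrite (chain_ideal_of (extendE f) (leqnn d)).
apply/idP/idP; apply: ideal_of_sub => r.
  by case=> i _ ->; apply: mem_ideal_of; exists i.
by case=> i ->; apply: mem_ideal_of; exists i.
Qed.

Lemma jacobian_vars (i : 'I_d) :
  \sum_(j < d) jacobian f i j * vars j = delta%:R * f i.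
Proof.
rewrite -(euler (f_form i)); apply: eq_bigr => j _.
by rewrite extendE mxE mulrC.
Qed.

(** Cramer's rule, as the product of the Jacobian matrix and the vector of variables is delta f. *)
Lemma var_det_jacobian (j : 'I_d) :
  'X_j * \det (jacobian f) \in ideal_of_forms.
Proof.
rewrite mulrC -[in X in _ * X](extendE (fun j => 'X_j)) cramer.
apply: ideal_sum => i _; rewrite jacobian_vars.
by do 2!apply: idealM; apply: mem_ideal_of; exists i.
Qed.

Hypothesis f_regular : regular_sequence f.

Lemma regular_forms : regular_mod (zero_ideal R) forms d.
Proof. exact: regular_sequence_mod (extendE f) f_regular. Qed.

(** Here B = 0 and, by Euler's formula, A may be the Jacobian matrix divided by delta. *)
Lemma socle_complete_intersection (u : R) :
  (forall j : 'I_d, 'X_j * u \in ideal_of_forms) ->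
  u \in adjoin ideal_of_forms (\det (jacobian f)).
Proof.
move=> socu; pose c : R := (delta%:R^-1)%:MP.
have c_delta : c * delta%:R = 1 by apply: mulVr_natr_mpoly.
have : u \in adjoin (chain (zero_ideal R) forms d) (\det (c *: jacobian f)).
  apply: (colon_regular_sequence (x := vars)) regular_forms _ _ => [i|j].
    under eq_bigr => j _ do rewrite mxE -mulrA.
    by rewrite -mulr_sumr jacobian_vars mulrA c_delta mul1r extendE subrr ideal0.
  by rewrite extendE chain_forms.
rewrite detZ; apply: adjoin_sub; last by apply: idealM; apply: mem_adjoin.
by move=> v; rewrite chain_forms; apply: sub_adjoin.
Qed.

(** Each f_i is a combination of the variables, so f_i v = a b_i with b_i in F. It suffices that
    b_0 be a multiple of f_0: this is the regularity of f_1 modulo f_0 applied to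
    f_1 b_0 = f_0 b_1, or the equality F = (f_0) when there is only one form. *)
Lemma colon_vars_divisible (a v : R) : (0 < d)%N -> a != 0 ->
  (forall j : 'I_d, 'X_j * v \in scale_ideal a ideal_of_forms) ->
  exists u, v = a * u.
Proof.
move=> d_gt0 a_neq0 av.
have c_delta := mulVr_natr_mpoly delta_neq0.
have fv (i : 'I_d) : exists2 b, b \in ideal_of_forms & f i * v = a * b.
  apply/scale_idealP; rewrite -[f i]mul1r -c_delta -(mulrA _ _ (f i)).
  rewrite -jacobian_vars -mulrA; apply: idealM; rewrite mulr_suml; apply: ideal_sum => j _.
  by rewrite -mulrA extendE; apply: idealM.
pose i0 : 'I_d := Ordinal d_gt0; have [b b_in fvb] := fv i0.
have f0_neq0 : f i0 != 0.
  apply/eqP => f0; have := regular_forms d_gt0 (v := 1).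
  by rewrite (extendE f i0) f0 mul0r /= !zero_idealE oner_eq0 eqxx => /(_ isT).
have /adjoinP[c] : b \in chain (zero_ideal R) forms 1.
  have [d_gt1|d_le1] := ltnP 1 d; last first.
    have d1 : d = 1%N by apply/eqP; rewrite eqn_leq d_le1.
    by move: b_in; rewrite -chain_forms [X in chain _ _ X]d1.
  pose i1 : 'I_d := Ordinal d_gt1; have [b1 _ fvb1] := fv i1.
  apply: (regular_forms d_gt1); apply/adjoinP; exists b1.
  rewrite /= zero_idealE (extendE f i1) (extendE f i0) subr_eq0; apply/eqP.
  apply: (mulfI a_neq0); transitivity (f i0 * f i1 * v).
    by rewrite mulrCA -fvb; ring.
  by rewrite -mulrA fvb1; ring.
rewrite /= zero_idealE (extendE f i0) subr_eq0 => /eqP bc; exists c.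
by apply: (mulfI f0_neq0); rewrite fvb bc; ring.
Qed.

Hypothesis delta_gamma_neq0 : (delta + gamma)%:R != 0 :> k.

Let I := ideal_of (fun r : R => r = G).
Let J := ideal_of (fun r : R => exists i : 'I_d, r = G * f i).
Let N := ideal_mul J (ideal_exp I d.-1).
Let K : R := \det (jacobian (fun i => G * f i)).

(** In zero variables [d.-1] is 0 rather than -1, but then F = 0 and all its multiples agree. *)
Lemma mem_JI (v : R) : (v \in N) = (v \in scale_ideal (G ^+ d) ideal_of_forms).
Proof.
rewrite /N ideal_mul_principal -/ideal_of_forms.
have [d_gt0|] := posnP d; last by move=> d_gt0; rewrite prednK.
have forms0 (u : R) : u \in ideal_of_forms -> u = 0.
  by rewrite -chain_forms [X in chain _ _ X]d_gt0 zero_idealE => /eqP.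
by apply/scale_idealP/scale_idealP=> -[u /[dup] u_in /forms0 u0 ->]; exists u => //;
   rewrite u0 !mulr0.
Qed.

Lemma jacobian_mulE :
  exists2 t : k, t != 0 & K = t%:MP * (G ^+ d * \det (jacobian f)).
Proof.
exists ((delta + gamma)%:R / delta%:R); first by rewrite mulf_neq0 ?invr_eq0.
apply: (mulfI (natr_mpoly_neq0 delta_neq0)); rewrite det_jacobian_mul.
rewrite -mulrA [RHS]mulrA; congr (_ * _).
by rewrite -!mpolyC_nat -mpolyCM mulrC divfK.
Qed.

(** The passage from v to v / G^d reduces the socle modulo G^d F to the socle modulo F; conversely
    the Jacobian determinant is a multiple of G^d det(df_i/dx_j), which the variables send into
    G^d F. *)
Lemma colon_vars_jacobian (v : R) :
  (forall j : 'I_d, 'X_j * v \in N) <-> v \in adjoin N K.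
Proof.
have [t t_neq0 KE] := jacobian_mulE; split=> [socv|/adjoinP[c Nv] j].
  have [u vu] : exists u, v = G ^+ d * u.
    have [d0|d_gt0] := posnP d; first by exists v; rewrite [X in _ ^+ X]d0 mul1r.
    apply: colon_vars_divisible; rewrite ?expf_neq0 // => j.
    by rewrite -mem_JI.
  have /socle_complete_intersection/adjoinP[c Fu] :
      forall j : 'I_d, 'X_j * u \in ideal_of_forms.
    move=> j; have := socv j; rewrite mem_JI => /scale_idealP[w Fw].
    by rewrite vu mulrCA => /(mulfI (expf_neq0 d G_neq0))->.
  apply/adjoinP; exists (c * (t^-1)%:MP); rewrite mem_JI.
  apply/scale_idealP; exists (u - c * \det (jacobian f)) => //.
  have tV : (t^-1)%:MP * t%:MP = 1 :> R by rewrite -mpolyCM mulVf ?mpolyC1.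
  by rewrite KE vu -(mulrA c) [X in c * X]mulrA tV mul1r; ring.
have Nj : 'X_j * v - 'X_j * (c * K) \in N by rewrite -mulrBr; apply: idealM.
rewrite (ideal_congr Nj) mulrCA; apply: idealM; rewrite KE mulrCA; apply: idealM.
rewrite mem_JI; apply/scale_idealP.
exists ('X_j * \det (jacobian f)); first exact: var_det_jacobian.
by rewrite mulrCA.
Qed.

Lemma annihilated_pi (v : R) :
  (forall a : R, a \in irrelevant_ideal k d -> a *: \pi_{ideal_quot N} v = 0)
    <-> forall j : 'I_d, 'X_j * v \in N.
Proof.
split=> [av j|socv a /asboolP[n [b [w [wX ->]]]]].
  rewrite -pi_eq0 -scale_pi; apply/eqP; apply: av.
  by apply: mem_ideal_of; exists j.
rewrite scaler_suml; apply: big1 => i _; have [j ->] := wX i.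
rewrite -[b i *: _]/(b i * _) -scalerA scale_pi.
by apply/eqP; rewrite scale_pi pi_eq0; apply: idealM.
Qed.

Lemma socle_quotE (u : {ideal_quot N}) :
  (u \in socle (M := {ideal_quot N}) predT)
    = (u \in submod_span (fun w => w = \pi_{ideal_quot N} K)).
Proof.
rewrite -[u]reprK span_pi; apply/andP/idP => [[_ /asboolP]|].
  by rewrite annihilated_pi colon_vars_jacobian.
by rewrite -colon_vars_jacobian -annihilated_pi => ann; split=> //; apply/asboolP.
Qed.

Lemma socle_submod_quotE (u : {ideal_quot N}) :
  (u \in socle (submod_quot (ideal_exp I d) N))
    = (u \in submod_span (fun w => w = \pi_{ideal_quot N} K)).
Proof.
rewrite -socle_quotE; apply/andP/idP => [[_ ann]|socu]; first exact/andP.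
split; last by case/andP: socu.
move: socu; rewrite socle_quotE -[u]reprK span_pi => /adjoinP[c Nu].
apply/asboolP; exists (repr u) => //.
have [t _ KE] := jacobian_mulE.
have sub (w : R) : w \in N -> w \in ideal_exp I d.
  rewrite mem_JI ideal_exp_principal => /scale_idealP[y _ ->].
  by apply/scale_idealP; exists y => //; apply: mem_unit_ideal.
rewrite (ideal_congr (sub _ Nu)); apply: idealM; rewrite KE; apply: idealM.
rewrite ideal_exp_principal; apply/scale_idealP.
by exists (\det (jacobian f)) => //; apply: mem_unit_ideal.
Qed.

End SocleOfForms.

Theorem proposition7p12 (k : fieldType) (d gamma delta : nat)
    (G : {mpoly k[d]}) (f : 'I_d -> {mpoly k[d]})
    (G_neq0 : G != 0) (G_form : G \is gamma.-homog)
    (f_form : forall i : 'I_d, f i \is delta.-homog)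
    (f_regular : regular_sequence f)
    (delta_neq0 : delta%:R != 0 :> k)
    (delta_gamma_neq0 : (delta + gamma)%:R != 0 :> k) :
  let I := ideal_of (fun r => r = G) in
  let J := ideal_of (fun r => exists i : 'I_d, r = G * f i) in
  let N := ideal_mul J (ideal_exp I d.-1) in
  let jac := \pi_{ideal_quot N} (\det (jacobian (fun i => G * f i))) in
  socle (M := {ideal_quot N}) predT =i submod_span (fun u => u = jac)
  /\ socle (submod_quot (ideal_exp I d) N) =i submod_span (fun u => u = jac).
Proof.
move=> I J N jac; split=> u; first exact: (socle_quotE G_neq0 G_form f_form).
exact: (socle_submod_quotE G_neq0 G_form f_form).
Qed.
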